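(* For every integer $n\ge 1$, the group $G(A^{(n)})$ defined by the Aleshin type automaton $A^{(n)}$ is a free group on $2n+1$ generators.
   Context: An automaton is a quadruple $(Q,X,\phi,\psi)$ with nonempty sets $Q$ (internal states) and $X$ (finite alphabet), a state transition function $\phi:Q\times X\to Q$ and an output function $\psi:Q\times X\to X$. Let $X^*$ be the set of finite words over $X$ (including the empty word). For an automaton $Y=(Q,X,\phi,\psi)$ and $q\in Q$, the transformation $Y_q:X^*\to X^*$ is defined recursively by $Y_q(\varnothing)=\varnothing$ and $Y_q(xw)=\psi(q,x)\,Y_{\phi(q,x)}(w)$ for $x\in X$, $w\in X^*$. $Y$ is invertible if all $Y_q$, $q\in Q$, are bijective; then $G(Y)$, the group defined by $Y$, is the group of transformations of $X^*$ generated (under composition) by $Y_q$, $q\in Q$. Aleshin type automata: for $n\ge1$, $A^{(n)}=(Q_n,\{0,1\},\phi_n,\psi_n)$, where $Q_1=\{a_1,b_1,c_1\}$ and $Q_n=\{a_n,b_n,c_n,q_{n1},\dots,q_{n,2n-2}\}$ for $n\ge2$ (a set of $2n+1$ elements). With $q_{n0}:=c_n$ and $q_{n,2n-1}:=a_n$: $\phi_n(a_n,0)=\phi_n(b_n,1)=c_n$, $\phi_n(a_n,1)=\phi_n(b_n,0)=b_n$, and $\phi_n(q_{ni},0)=\phi_n(q_{ni},1)=q_{n,i+1}$ for $0\le i\le 2n-2$. For $x\in\{0,1\}$: $\psi_n(q,x)=1-x$ if $q\in\{a_n,b_n\}$, and $\psi_n(q,x)=x$ if $q\in Q_n\setminus\{a_n,b_n\}$.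 These automata are invertible. *)

(* Defs.v *)
From HB Require Import structures.
From mathcomp Require Import all_boot.
From mathcomp Require Import boolp classical_sets.

Set Implicit Arguments.
Unset Strict Implicit.
Unset Printing Implicit Defensive.

Local Open Scope classical_set_scope.
Local Open Scope group_scope.

(* Bijective transformations of a type, as a group under composition:
   (f * g) x = f (g x). *)
Record bijection (T : Type) := Bijection {
  bij_fun :> T -> T;
  bij_funP : bijective bij_fun
}.

Section BijectionGroup.
Variable T : Type.
Implicit Types f g h : bijection T.

HB.instance Definition _ := gen_eqMixin (bijection T).
HB.instance Definition _ := gen_choiceMixin (bijection T).

Lemma bijection_eq f g : f =1 g -> f = g.
Proof.
case: f g => f fP [g gP] /= /funext fg; rewrite fg in fP *.
by congr Bijection; apply: Prop_irrelevance.
Qed.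

Definition bij_one : bijection T := Bijection (inv_bij (frefl id)).

Definition bij_mul f g : bijection T :=
  Bijection (bij_comp (bij_funP f) (bij_funP g)).

Lemma bij_inv_ex f : exists g, cancel f g /\ cancel g f.
Proof.
by case: (bij_funP f) => g fK gK; exists (Bijection (Bijective gK fK)).
Qed.

Definition bij_inv f : bijection T := sval (cid (bij_inv_ex f)).

Lemma bij_funK f : cancel f (bij_inv f).
Proof. by case: (svalP (cid (bij_inv_ex f))). Qed.

Lemma bij_invK f : cancel (bij_inv f) f.
Proof. by case: (svalP (cid (bij_inv_ex f))). Qed.

Lemma bij_mulA : associative bij_mul.
Proof. by move=> f g h; apply: bijection_eq. Qed.

Lemma bij_mul1 : left_id bij_one bij_mul.
Proof. by move=> f; apply: bijection_eq. Qed.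

Lemma bij_mulr1 : right_id bij_one bij_mul.
Proof. by move=> f; apply: bijection_eq. Qed.

Lemma bij_mulV : left_inverse bij_one bij_inv bij_mul.
Proof. by move=> f; apply: bijection_eq; exact: bij_funK. Qed.

Lemma bij_mulrV : right_inverse bij_one bij_inv bij_mul.
Proof. by move=> f; apply: bijection_eq; exact: bij_invK. Qed.

HB.instance Definition _ := isGroup.Build (bijection T)
  bij_mulA bij_mul1 bij_mulr1 bij_mulV bij_mulrV.

End BijectionGroup.

Section GeneratedSubgroup.
Variables (G : groupType) (S : set G).

Definition is_subgroup (A : set G) :=
  [/\ A 1, forall x y, A x -> A y -> A (x * y) & forall x, A x -> A x^-1].

Definition generated : pred G :=
  fun x => `[< forall A : set G, is_subgroup A -> S `<=` A -> A x >].

Lemma generated_closed : group_closed generated.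
Proof.
split=> [|x y]; rewrite !unfold_in; first by apply/asboolP => A [].
move=> /asboolP xS /asboolP yS; apply/asboolP => A AG SA.
by case: (AG) => _ AM AV; exact: AM (xS A AG SA) (AV _ (yS A AG SA)).
Qed.

Definition generated_group := {x : G | generated x}.

HB.instance Definition _ := SubChoice.on generated_group.
HB.instance Definition _ :=
  SubChoice_isSubGroup.Build G generated generated_group generated_closed.

End GeneratedSubgroup.

(* Universal property: every map from the basis to a group extends uniquely to
   a homomorphism. *)
Definition is_free_basis (G : groupType) (k : nat) (e : 'I_k -> G) :=
  forall (H : groupType) (f : 'I_k -> H),
    exists phi : {multiplicative G -> H},
      (forall i, phi (e i) = f i) /\
      (forall psi : {multiplicative G -> H},
         (forall i, psi (e i) = f i) -> psi =1 phi).

Definition is_free_group (G : groupType) (k : nat) :=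
  exists e : 'I_k -> G, is_free_basis e.

Record automaton := Automaton {
  state : Type;
  letter : finType;
  state_nonempty : inhabited state;
  letter_nonempty : inhabited letter;
  transition : state -> letter -> state;
  output : state -> letter -> letter
}.

Fixpoint transformation (Y : automaton) (q : state Y) (w : seq (letter Y)) :
    seq (letter Y) :=
  if w is x :: w' then output q x :: transformation (transition q x) w'
  else [::].

Definition invertible (Y : automaton) :=
  forall q : state Y, bijective (transformation q).

Definition automaton_group (Y : automaton) (invY : invertible Y) : groupType :=
  generated_group [set Bijection (invY q) | q in [set: state Y]].

(* [Aleshin_q j] is the state q_{n,j+1}. *)
Inductive aleshin_state (n : nat) :=
  | Aleshin_a | Aleshin_b | Aleshin_c | Aleshin_q of 'I_(2 * n - 2).

Arguments Aleshin_a {n}.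
Arguments Aleshin_b {n}.
Arguments Aleshin_c {n}.

(* The state q_{n,i} for 0 <= i <= 2n-1, with the conventions q_{n,0} = c_n and
   q_{n,2n-1} = a_n; the value for i >= 2n is irrelevant. *)
Definition aleshin_chain (n i : nat) : aleshin_state n :=
  if i is i'.+1 then
    if insub i' is Some j then Aleshin_q j else Aleshin_a
  else Aleshin_c.

(* The letters 0 and 1 are encoded as [false] and [true]. *)
Definition aleshin_transition (n : nat) (q : aleshin_state n) (x : bool) :
    aleshin_state n :=
  match q with
  | Aleshin_a => if x then Aleshin_b else Aleshin_c
  | Aleshin_b => if x then Aleshin_c else Aleshin_b
  | Aleshin_c => aleshin_chain n 1
  | Aleshin_q j => aleshin_chain n j.+2
  end.

Definition aleshin_output (n : nat) (q : aleshin_state n) (x : bool) : bool :=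
  match q with
  | Aleshin_a | Aleshin_b => ~~ x
  | Aleshin_c | Aleshin_q _ => x
  end.

Definition aleshin (n : nat) : automaton :=
  Automaton (inhabits Aleshin_a) (inhabits true)
    (@aleshin_transition n) (@aleshin_output n).

Lemma aleshin_invertible (n : nat) : invertible (aleshin n).
Proof.
pose fix g (q : aleshin_state n) (w : seq bool) : seq bool :=
  if w is y :: w' then
    aleshin_output q y :: g (aleshin_transition q (aleshin_output q y)) w'
  else [::].
have outK (q : aleshin_state n) : involutive (aleshin_output q).
  by case: q => [|||j] x //=; rewrite negbK.
move=> q; exists (g q) => w; elim: w q => //= x w IHw q.
  by rewrite outK IHw.
by rewrite IHw outK.
Qed.

Arguments aleshin_invertible n : clear implicits.

(* Main.v *)
(* A word over the states and their inverses acts trivially only if all its sections do, so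
   the set of trivial words is closed under the dual automaton, whose two transformations
   [section false] and [section true] permute the words of a given sign pattern.  Both are
   the relabelling [p = (c q_1 ... q_(2n-2) a)] followed by [twist], an involution swapping
   [b] and [c] at the places selected by a parity count.  The quotient of the two is the
   relabelling [(b c)], a conjugate of which is [(a b)]; since [p (a c)] has odd order and
   fixes [b] and [c], an odd power of [section false] composed with [(a c)] is [twist]
   itself.  Hence trivial words are closed under [twist] and all relabellings.
   These act transitively on the reduced words of each sign pattern.  For three letters this
   is an induction on the length; with more letters, every reduced word is moved into
   [{a, b, c}], one letter at a time.  Each nonempty pattern carries a reduced word with an
   odd number of letters [a] and [b], which acts nontrivially, so no nonempty reduced word
   is trivial. *)

From HB Require Import structures.
Require Import Defs.
From mathcomp Require Import all_boot.
From mathcomp Require Import fingroup perm boolp classical_sets zify.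

Set Implicit Arguments.
Unset Strict Implicit.
Unset Printing Implicit Defensive.

Local Open Scope group_scope.

(** * Signed words, cancellation and formal inverses *)

Section SignedWords.
Variable Q : eqType.
Implicit Types (l : bool * Q) (u v w : seq (bool * Q)).

(* A signed word lists letters [(e, q)], meaning [q^-1] if [e] and [q] otherwise. *)
Definition nocancel l l' := (l.1 == l'.1) || (l.2 != l'.2).

Definition reduced w := sorted nocancel w.

Definition inv_letter l := (~~ l.1, l.2).

Definition inv_word w := rev (map inv_letter w).

Lemma inv_letterK : involutive inv_letter.
Proof. by case=> e q; rewrite /inv_letter /= negbK. Qed.

Lemma inv_wordK : involutive inv_word.
Proof.
move=> w; rewrite /inv_word map_rev revK -map_comp map_id_in // => l _ /=.
exact: inv_letterK.
Qed.

Lemma inv_word_cons l w : inv_word (l :: w) = rcons (inv_word w) (inv_letter l).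
Proof. by rewrite /inv_word /= rev_cons. Qed.

Lemma size_inv_word w : size (inv_word w) = size w.
Proof. by rewrite size_rev size_map. Qed.

Lemma signs_inv_word w : unzip1 (inv_word w) = rev (map negb (unzip1 w)).
Proof. by rewrite /inv_word /unzip1 map_rev -!map_comp. Qed.

Lemma nocancel_sym : symmetric nocancel.
Proof. by move=> l l'; rewrite /nocancel eq_sym [l.2 == _]eq_sym. Qed.

Lemma reduced_inv_word w : reduced (inv_word w) = reduced w.
Proof.
rewrite /reduced /inv_word rev_sorted sorted_map; apply: eq_sorted => l l' /=.
by rewrite nocancel_sym /nocancel /= (inj_eq negb_inj).
Qed.

Lemma reduced_rcons w l l' :
  reduced (rcons (rcons w l) l') = reduced (rcons w l) && nocancel l l'.
Proof. by rewrite /reduced; case: w => [|x w] /=; rewrite ?andbT // rcons_path last_rcons. Qed.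

Lemma reducedW w l : reduced (rcons w l) -> reduced w.
Proof. by rewrite /reduced; case: w => [|x w] //=; rewrite rcons_path => /andP[]. Qed.

Definition relabel (Q' : Type) (f : Q -> Q') (w : seq (bool * Q)) : seq (bool * Q') :=
  [seq (l.1, f l.2) | l <- w].

Lemma signs_relabel (Q' : Type) (f : Q -> Q') w :
  unzip1 (relabel f w) = unzip1 w.
Proof. by rewrite /relabel /unzip1 -map_comp. Qed.

Lemma relabel_id_in (f : Q -> Q) w : {in unzip2 w, f =1 id} -> relabel f w = w.
Proof.
move=> fid; rewrite /relabel -[RHS]map_id; apply/eq_in_map => -[e q] qw /=.
by rewrite fid //; apply/mapP; exists (e, q).
Qed.

End SignedWords.

Lemma reduced_relabel (Q Q' : eqType) (f : Q -> Q') w :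
  injective f -> reduced (relabel f w) = reduced w.
Proof.
move=> fI; rewrite /reduced sorted_map; apply: eq_sorted => l l'.
by rewrite /nocancel /= (inj_eq fI).
Qed.

(** * The twist and its orbits on signed words *)

Section Orbits.
Variables (Q : finType) (b c : Q).
Implicit Types (l : bool * Q) (u v w : seq (bool * Q)).


Let swapped q := (q == b) || (q == c).

Fixpoint twist_end (s : bool) w :=
  if w is l :: w' then twist_end (s (+) swapped l.2) w' else s.

(* [twist s] swaps [b] and [c] in the letter [(e, q)] when the state [s],
   toggled by every earlier [b] or [c], differs from [e]. *)
Fixpoint twist (s : bool) w :=
  if w is (e, q) :: w' then
    (e, if s (+) e then tperm b c q else q) :: twist (s (+) swapped q) w'
  else [::].

Lemma swapped_tperm q : swapped (tperm b c q) = swapped q.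
Proof. by rewrite /swapped; case: tpermP => [->|->|]; rewrite ?eqxx ?orbT. Qed.

Lemma swappedN q : ~~ swapped q -> tperm b c q = q.
Proof. by rewrite negb_or => /andP[? ?]; rewrite tpermD // eq_sym. Qed.

Lemma twist_cat s u v : twist s (u ++ v) = twist s u ++ twist (twist_end s u) v.
Proof. by elim: u s => [|[e q] u IH] s //=; rewrite IH. Qed.

Lemma twist_rcons s u l :
  twist s (rcons u l) = rcons (twist s u)
    (l.1, if twist_end s u (+) l.1 then tperm b c l.2 else l.2).
Proof. by rewrite -cats1 twist_cat; case: l => e q; rewrite -cats1. Qed.

Lemma twist_end_rcons s u l :
  twist_end s (rcons u l) = twist_end s u (+) swapped l.2.
Proof. by elim: u s => /=. Qed.

Lemma signs_twist s w : unzip1 (twist s w) = unzip1 w.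
Proof. by elim: w s => [|[e q] w IH] s //=; rewrite IH. Qed.

Lemma twist_negb s w : twist (~~ s) w = relabel (tperm b c) (twist s w).
Proof.
elim: w s => [|[e q] w IH] s //=; rewrite addNb -IH addNb.
by congr cons; congr pair; case: (s (+) e); rewrite /= ?tpermK.
Qed.

Lemma twistK s : involutive (twist s).
Proof.
move=> w; elim: w s => [|[e q] w IH] s //=.
have -> : swapped (if s (+) e then tperm b c q else q) = swapped q.
  by case: ifP; rewrite ?swapped_tperm.
by rewrite IH; case: (s (+) e); rewrite ?tpermK.
Qed.

Lemma twist_tperm s w : twist s (relabel (tperm b c) w) = twist (~~ s) w.
Proof. by rewrite -{1}[w](twistK (~~ s)) -twist_negb negbK twistK. Qed.

Lemma twist_endK s w : twist_end (twist_end s w) (inv_word w) = s.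
Proof.
elim: w s => [|l w IH] s //=; rewrite inv_word_cons twist_end_rcons IH.
by rewrite addbK.
Qed.

(** At a letter [b] or [c], inversion flips the sign and the backward reading meets the toggled
    state, so the two changes cancel; other letters are fixed by the swap. *)
Lemma twist_inv_word s w : twist (twist_end s w) (inv_word w) = inv_word (twist s w).
Proof.
elim: w s => [|[e q] w IH] s //=.
rewrite !inv_word_cons twist_rcons IH twist_endK /inv_letter /=.
have [qbc|/swappedN qbc] := boolP (swapped q).
  by rewrite addbN addbT addNb negbK.
by rewrite qbc !if_same.
Qed.

(** At a sign change, a first letter [b] or [c] toggles the state together with the sign, so both
    letters are swapped or neither; any other first letter is fixed by the swap and stays distinct
    from its neighbour. *)
Lemma reduced_twist s w : reduced w -> reduced (twist s w).
Proof.
rewrite /reduced; case: w => [|[e q] w] //=.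
elim: w s e q => [|[e' q'] w IH] s e q //= /andP[qq' /IH ->].
rewrite andbT; move: qq'; rewrite /nocancel /=.
have [//|ne /=] := eqVneq e e'; have -> : e' = ~~ e by case: e e' ne => [] [].
rewrite addbN -addbA -addbN addbN => qq'.
have [qbc|qbc] := boolP (swapped q).
  rewrite addTb addbN negbK; case: (s (+) e) => //.
  by rewrite (inj_eq perm_inj).
rewrite (swappedN qbc) if_same; case: ifP => // _.
by rewrite -[X in X != _](swappedN qbc) (inj_eq (@perm_inj _ _)).
Qed.

(** Forward steps suffice for an equivalence relation, since every generating move is an
    involution. *)
Inductive orbit u : seq (bool * Q) -> Prop :=
  | orbit_refl : orbit u u
  | orbit_tperm x y v : orbit u v -> orbit u (relabel (tperm x y) v)
  | orbit_twist s v : orbit u v -> orbit u (twist s v).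

Lemma orbit_trans u v w : orbit u v -> orbit v w -> orbit u w.
Proof.
move=> uv; elim=> [|x y {}w _ IH|s {}w _ IH] //; first exact: orbit_tperm.
exact: orbit_twist.
Qed.

Lemma relabel_tpermK (x y : Q) : involutive (relabel (tperm x y)).
Proof.
move=> w; rewrite /relabel -map_comp map_id_in // => -[e q] _ /=.
by rewrite tpermK.
Qed.

Lemma orbit_sym u v : orbit u v -> orbit v u.
Proof.
elim=> [|x y {}v _ IH|s {}v _ IH]; first exact: orbit_refl.
  apply: orbit_trans IH; rewrite -{2}[v](relabel_tpermK x y).
  exact/orbit_tperm/orbit_refl.
by apply: orbit_trans IH; rewrite -{2}[v](twistK s); apply/orbit_twist/orbit_refl.
Qed.

Lemma orbit_reduced u v : orbit u v -> reduced u -> reduced v.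
Proof.
move=> uv ru; elim: uv => // [x y|s] {}v _ IH; last exact: reduced_twist.
by rewrite reduced_relabel //; apply: perm_inj.
Qed.

Lemma orbit_inv_word u v : orbit u v -> orbit (inv_word u) (inv_word v).
Proof.
elim=> [|x y {}v _ IH|s {}v _ IH]; first exact: orbit_refl.
  suff -> : inv_word (relabel (tperm x y) v) = relabel (tperm x y) (inv_word v).
    exact: orbit_tperm.
  by rewrite /inv_word /relabel map_rev -!map_comp.
by rewrite -twist_inv_word; apply: orbit_twist.
Qed.

(** A move treats a prefix without looking at what follows, and permutes the last letter in a way
    that depends only on the prefix and the sign [e]. *)
Lemma orbit_rcons u v e : orbit u v ->
  exists2 f : Q -> Q, injective f & forall x, orbit (rcons u (e, x)) (rcons v (e, f x)).
Proof.
elim=> [|x y {}v _ [f fI fP]|s {}v _ [f fI fP]].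
- by exists id => // x; apply: orbit_refl.
- exists (tperm x y \o f) => [|z]; first exact: inj_comp perm_inj fI.
  by have := orbit_tperm x y (fP z); rewrite /relabel map_rcons.
- exists (fun x => if twist_end s v (+) e then tperm b c (f x) else f x) => [x y|x].
    by case: ifP => _ => [/perm_inj|] /fI.
  by have := orbit_twist s (fP x); rewrite twist_rcons.
Qed.

(** A twist of the tail from state [s] is induced by a twist of the whole word, started in [s]
    toggled by the first letter. *)
Lemma orbit_cons u v e x : orbit u v -> exists y, orbit ((e, x) :: u) ((e, y) :: v).
Proof.
elim=> [|y z {}v _ [t tP]|s {}v _ [t tP]]; first by exists x; apply: orbit_refl.
  by exists (tperm y z t); have := orbit_tperm y z tP.
exists (if s (+) swapped t (+) e then tperm b c t else t).
by have := orbit_twist (s (+) swapped t) tP; rewrite /= addbK.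
Qed.

End Orbits.

(** * Transitivity over an alphabet of three letters *)

Section ThreeLetters.
Variables (Q : finType) (a b c : Q).
Hypotheses (neq_ab : a != b) (neq_ac : a != c) (neq_bc : b != c).
Hypothesis letters : forall q, [|| q == a, q == b | q == c].
Implicit Types (u v w : seq (bool * Q)) (p : seq bool).

(* A letter [b] or [c] is used exactly where the sign is about to change (to [z] at the
   end), so that the state of [twist] follows the signs and nothing is swapped. *)
Fixpoint fixed_word (z : bool) p : seq (bool * Q) :=
  if p is e :: p' then
    (e, if e == head z p' then a else if e then b else c) :: fixed_word z p'
  else [::].

Lemma signs_fixed_word z p : unzip1 (fixed_word z p) = p.
Proof. by elim: p => //= e p ->. Qed.

Lemma fixed_word_rcons z p e :
  fixed_word z (rcons p e) =
    rcons (fixed_word e p) (e, if e == z then a else if e then b else c).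
Proof. by elim: p => //= e' p ->; congr cons; case: p. Qed.

(** Where the sign changes, the earlier letter is [b] or [c] according to its sign, and the later
    one is [a] or the other of the two. *)
Lemma reduced_fixed_word z p : reduced (fixed_word z p).
Proof.
elim/last_ind: p z => // p e IH z; elim/last_ind: p IH => [|p e' _] IH //.
have:= IH e; rewrite fixed_word_rcons 2!fixed_word_rcons => red.
rewrite reduced_rcons red /nocancel /=.
have [//|ne /=] := eqVneq e' e; case: (e == z); case: e' e ne {IH red} => [] [] //= _;
  by rewrite // 1?eq_sym // neq_bc.
Qed.

Let a_fixed : (a == b) || (a == c) = false.
Proof. by rewrite (negbTE neq_ab) (negbTE neq_ac). Qed.

Let state_step e z :
  let q := if e == z then a else if e then b else c in e (+) ((q == b) || (q == c)) = z.
Proof.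
have [->|] /= := eqVneq e z; first by rewrite a_fixed addbF.
by case: e z => [] []; rewrite //= eqxx ?orbT.
Qed.

Lemma twist_end_fixed_word z p : twist_end b c (head z p) (fixed_word z p) = z.
Proof. by elim: p => //= e p; rewrite (state_step e (head z p)). Qed.

Lemma twist_fixed_word z p : twist b c (head z p) (fixed_word z p) = fixed_word z p.
Proof.
by elim: p => //= e p; rewrite (state_step e (head z p)) addbb /= => ->.
Qed.

(** Started in [head (~~ e) p], the twist fixes the prefix and reaches the last letter in state
    [~~ e], opposite to its sign. *)
Lemma orbit_fixed_rcons p e :
  orbit b c (rcons (fixed_word (~~ e) p) (e, b)) (rcons (fixed_word (~~ e) p) (e, c)).
Proof.
have := orbit_twist (head (~~ e) p) (orbit_refl b c (rcons (fixed_word (~~ e) p) (e, b))).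
by rewrite twist_rcons twist_fixed_word twist_end_fixed_word /= addNb addbb tpermL.
Qed.

Let orbit_fixed_rcons_neq p e x :
  x != a ->
  orbit b c (rcons (fixed_word (~~ e) p) (e, x)) (rcons (fixed_word (~~ e) p) (e, b)).
Proof.
case/or3P: (letters x) => /eqP-> => [/eqP//|_|_]; first exact: orbit_refl.
exact/orbit_sym/orbit_fixed_rcons.
Qed.

Definition transitive_at k := forall u v, size u = k ->
  unzip1 u = unzip1 v -> reduced u -> reduced v -> orbit b c u v.

(* The word obtained from the prefix cannot be extended by [a] without cancellation, and
   [twist] exchanges its other two extensions. *)
Lemma orbit_change_last k u x y e : transitive_at k.+1 -> size u = k ->
  reduced (rcons (rcons u (~~ e, x)) (e, y)) ->
  orbit b c (rcons (rcons u (~~ e, x)) (e, y))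
    (rcons (fixed_word (~~ e) (rcons (unzip1 u) (~~ e))) (e, b)).
Proof.
move=> tr su red.
set v := fixed_word _ _.
have uv : orbit b c (rcons u (~~ e, x)) v.
  apply: tr; first by rewrite size_rcons su.
  - by rewrite signs_fixed_word /unzip1 map_rcons.
  - exact: reducedW red.
  - exact: reduced_fixed_word.
have [f _ /(_ y) fP] := orbit_rcons e uv.
apply: (orbit_trans fP); apply: orbit_fixed_rcons_neq.
have /orbit_reduced /(_ red) := fP.
rewrite /v fixed_word_rcons reduced_rcons eqxx /nocancel /= => /andP[_].
by rewrite [f y == a]eq_sym; case: (e).
Qed.

(* [twist] exchanges the first letters [b] and [c] in front of [v := fixed_word e' _].  So at
   least two of the words [v ++ [:: (e', a)]], [v ++ [:: (e', b)]], [v ++ [:: (e', c)]] can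
   be reached with the same first letter, that is, some word of the previous length has two
   extensions in the orbit; one of them is moved to an extension by [b] or [c]. *)
Lemma orbit_same_ends k u x y e e' : transitive_at k.+1 -> size u = k ->
  head e' (unzip1 u) = e -> last e (unzip1 u) = e' ->
  reduced ((e, x) :: rcons u (e', y)) ->
  orbit b c ((e, x) :: rcons u (e', y))
    (rcons (fixed_word (~~ e') (e :: unzip1 u)) (e', b)).
Proof.
move=> tr su he le red; set W := _ :: _ in red *.
set v := fixed_word e' (unzip1 u).
have red_v z : reduced (rcons v (e', z)).
  rewrite /v; elim/last_ind: (unzip1 u) le => // p e1 _; rewrite last_rcons => ->.
  have:= reduced_fixed_word e' (rcons p e'); rewrite fixed_word_rcons => rp.
  by rewrite reduced_rcons rp /nocancel eqxx.
have reach z : exists t, orbit b c W ((e, t) :: rcons v (e', z)).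
  apply: orbit_cons; apply: tr => //; first by rewrite size_rcons su.
  - by rewrite /unzip1 !map_rcons -!/(unzip1 _) signs_fixed_word.
  - by apply: path_sorted red.
(* Started in [~~ e], the twist swaps the first letter, enters [v] in state [e], fixes [v], and
   meets the last letter in state [e'], which leaves it alone. *)
have swap z : orbit b c ((e, b) :: rcons v (e', z)) ((e, c) :: rcons v (e', z)).
  have := orbit_twist (~~ e) (orbit_refl b c ((e, b) :: rcons v (e', z))).
  rewrite /= eqxx addNb addbb /= tpermL addbT negbK twist_rcons /=.
  have := (twist_fixed_word e' (unzip1 u), twist_end_fixed_word e' (unzip1 u)).
  by rewrite he -/v => -[-> ->]; rewrite addbb.
have reach2 z : orbit b c W ((e, a) :: rcons v (e', z)) \/
                orbit b c W ((e, b) :: rcons v (e', z)).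
  have [t Wt] := reach z.
  case/or3P: (letters t) Wt => /eqP-> Wt; [by left|by right|right].
  exact: orbit_trans Wt (orbit_sym (swap z)).
have [t [z1 [z2 [z12 W1 W2]]]] : exists t z1 z2, [/\ z1 != z2,
    orbit b c W ((e, t) :: rcons v (e', z1)) & orbit b c W ((e, t) :: rcons v (e', z2))].
  case: (reach2 a) (reach2 b) (reach2 c) => [Wa|Wa] [Wb|Wb] [Wc|Wc].
  - by exists a, a, b.
  - by exists a, a, b.
  - by exists a, a, c.
  - by exists b, b, c.
  - by exists a, b, c.
  - by exists b, a, c.
  - by exists b, a, b.
  - by exists b, a, b.
have tv : orbit b c ((e, t) :: v) (fixed_word (~~ e') (e :: unzip1 u)).
  apply: tr; first by rewrite /= -(size_map fst) -/(unzip1 v) signs_fixed_word size_map su.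
  - by rewrite signs_fixed_word /= signs_fixed_word.
  - by have:= orbit_reduced W1 red; rewrite -rcons_cons => /reducedW.
  - exact: reduced_fixed_word.
have [f fI fP] := orbit_rcons e' tv.
have [f1|f1] := eqVneq (f z1) a; last first.
  exact: orbit_trans (orbit_trans W1 (fP z1)) (orbit_fixed_rcons_neq _ _ f1).
apply: orbit_trans (orbit_trans W2 (fP z2)) (orbit_fixed_rcons_neq _ _ _).
by rewrite -f1 (inj_eq fI) eq_sym.
Qed.

(** Induction on the length, by where the signs change: between the last two letters, between the
    first two, or at neither end. *)
Lemma orbit_three_letters u v :
  unzip1 u = unzip1 v -> reduced u -> reduced v -> orbit b c u v.
Proof.
suff tr k : transitive_at k by apply: (tr (size u)).
elim: k => [|[|k] IH] {}u {}v su uv ru rv.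
- move: uv; rewrite (size0nil su) => /esym/(congr1 size) /=.
  by rewrite size_map => /size0nil ->; apply: orbit_refl.
- have := congr1 size uv; rewrite !size_map su.
  case: u v su uv {ru rv} => [|[e x] []] //= [|[e' y] []] //= _ [<-] _.
  by have := orbit_tperm x y (orbit_refl b c [:: (e, x)]); rewrite /= tpermL.
(* With a sign change at the end, both words reach a normal form that depends only on the signs. *)
have normal u' v' : size u' = k -> forall e e' x x' y y',
    unzip1 u' = unzip1 v' -> e != e' ->
    reduced (rcons (rcons u' (e, x)) (e', y)) ->
    reduced (rcons (rcons v' (e, x')) (e', y')) ->
    orbit b c (rcons (rcons u' (e, x)) (e', y)) (rcons (rcons v' (e, x')) (e', y')).
  move=> su' e e' x x' y y' uv' ne; have -> : e = ~~ e' by case: e e' ne => [] [].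
  move=> ru' rv'; apply: orbit_trans (orbit_change_last IH su' ru') _.
  rewrite uv'; apply/orbit_sym/(orbit_change_last IH) => //.
  by have := congr1 size uv'; rewrite !size_map => <-.
have cat2 w : size w = k.+2 -> exists e x w' e' y,
  w = (e, x) :: rcons w' (e', y) /\ size w' = k.
  case: w => [|[e x] w] //= [sw]; elim/last_ind: w sw => // w [e' y] _.
  by rewrite size_rcons => -[sw]; exists e, x, w, e', y.
have su2 : size v = k.+2 by have := congr1 size uv; rewrite !size_map => <-.
have [e [x [u' [e' [y [uE su']]]]]] := cat2 _ su.
have [f [x' [v' [f' [y' [vE sv']]]]]] := cat2 _ su2.
have [ef uv' ef'] : [/\ e = f, unzip1 u' = unzip1 v' & e' = f'].
  by move: uv; rewrite uE vE /unzip1 /= !map_rcons => -[-> /rcons_inj[-> ->]].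
rewrite {}uE {}vE -{}ef -{}ef' {uv su su2 f f'} in ru rv *.
have [le|le] := eqVneq (last e (unzip1 u')) e'; last first.
  have lastE (w : seq (bool * Q)) z : exists t w',
      (e, z) :: w = rcons w' (last e (unzip1 w), t) /\ size w' = size w.
    elim/last_ind: w => [|w [e1 z1] _]; first by exists z, [::].
    by exists z1, ((e, z) :: w); rewrite /unzip1 map_rcons last_rcons size_rcons.
  have [t [w [uE sw]]] := lastE u' x; have [t' [w' [vE sw']]] := lastE v' x'.
  have ww' : unzip1 w = unzip1 w'.
    have := congr1 unzip1 uE; have := congr1 unzip1 vE.
    by rewrite /unzip1 !map_rcons /= -!/(unzip1 _) uv' => -> /rcons_inj[].
  move: ru rv; rewrite -!rcons_cons uE vE -uv' => ru rv.
  by apply: normal => //; rewrite sw.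
have [he|he] := eqVneq (head e' (unzip1 u')) e.
  apply: orbit_trans (orbit_same_ends IH su' he le ru) _.
  by rewrite uv' in he le *; apply/orbit_sym/(orbit_same_ends IH sv').
have headE (w : seq (bool * Q)) z : exists t w',
    rcons w (e', z) = (head e' (unzip1 w), t) :: w' /\ size w' = size w.
  case: w => [|[e1 z1] w]; first by exists z, [::].
  by exists z1, (rcons w (e', z)); rewrite size_rcons.
have [t [w [uE sw]]] := headE u' y; have [t' [w' [vE sw']]] := headE v' y'.
have ww' : unzip1 w = unzip1 w'.
  have := congr1 unzip1 uE; have := congr1 unzip1 vE.
  by rewrite /unzip1 !map_rcons /= -!/(unzip1 _) uv' => -> [].
move: ru rv; rewrite uE vE -uv' => ru rv.
(* Formal inversion carries the sign change from the front to the end. *)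
rewrite -[_ :: _]inv_wordK -[X in orbit _ _ _ X]inv_wordK; apply: orbit_inv_word.
rewrite !inv_word_cons; apply: normal; first by rewrite size_inv_word sw.
- by rewrite !signs_inv_word ww'.
- by rewrite (inj_eq negb_inj).
- by rewrite -reduced_inv_word !inv_word_cons in ru.
- by rewrite -reduced_inv_word !inv_word_cons in rv.
Qed.

End ThreeLetters.

(** * Transitivity over a finite alphabet with three distinguished letters *)

Lemma relabel_twist (Q Q' : finType) (f : Q -> Q') b c s w :
  injective f -> relabel f (twist b c s w) = twist (f b) (f c) s (relabel f w).
Proof.
move=> fI; elim: w s => [|[e q] w IH] s //=; rewrite IH !(inj_eq fI).
by case: ifP => // _; rewrite inj_tperm.
Qed.

Lemma relabel_tperm (Q Q' : finType) (f : Q -> Q') (x y : Q) w :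
  injective f ->
  relabel f (relabel (tperm x y) w) = relabel (tperm (f x) (f y)) (relabel f w).
Proof.
by move=> fI; rewrite /relabel -!map_comp; apply: eq_map => l /=; rewrite inj_tperm.
Qed.

Section Transitivity.
Variables (Q : finType) (a b c : Q).
Hypotheses (neq_ab : a != b) (neq_ac : a != c) (neq_bc : b != c).
Implicit Types (u v w : seq (bool * Q)) (p : seq bool).

Lemma orbit_relabel (Q' : finType) (f : Q' -> Q) b' c' (u v : seq (bool * Q')) :
  injective f -> orbit b' c' u v -> orbit (f b') (f c') (relabel f u) (relabel f v).
Proof.
move=> fI; elim=> [|x y {}v _ IH|s {}v _ IH]; first exact: orbit_refl.
  by rewrite relabel_tperm //; apply: orbit_tperm.
by rewrite relabel_twist //; apply: orbit_twist.
Qed.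

Let embed (x : option bool) := if x is Some y then if y then c else b else a.

Let embed_inj : injective embed.
Proof.
by case=> [[]|] [[]|] //= /eqP; rewrite 1?[c == _]eq_sym 1?[b == a]eq_sym
  ?(negbTE neq_ab) ?(negbTE neq_ac) ?(negbTE neq_bc).
Qed.

(** Letting the sign choose the letter makes neighbours of opposite sign differ, so nothing
    cancels. *)
Let two_letters p : seq (bool * option bool) :=
  [seq (e, if e then None else Some false) | e <- p].

Let signs_two_letters p : unzip1 (two_letters p) = p.
Proof. by rewrite /unzip1 -map_comp map_id. Qed.

Let reduced_two_letters p : reduced (two_letters p).
Proof.
rewrite /reduced sorted_map; case: p => //= e p; elim: p e => //= e' p IH e.
by rewrite IH andbT; case: e e' => [] [].
Qed.

(* A last letter other than [a] and [b] can be replaced by [c] without changing the rest of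
   a word in [a] and [b]. *)
Let orbit_two_letters w :
  reduced w -> orbit b c w (relabel embed (two_letters (unzip1 w))).
Proof.
elim/last_ind: w => [|w [e x] IH] red; first exact: orbit_refl.
have [f _ /(_ x) fP] := orbit_rcons e (IH (reducedW red)).
suff [y yP] : exists y, orbit b c (rcons w (e, x))
    (relabel embed (rcons (two_letters (unzip1 w)) (e, y))).
  (* Both words now use only letters in the image of [embed], so the three-letter case applies. *)
  apply: (orbit_trans yP); apply: (@orbit_relabel _ embed (Some false) (Some true)) => //.
  have twoE : unzip1 (rcons w (e, x)) = rcons (unzip1 w) e by rewrite /unzip1 map_rcons.
  apply: (@orbit_three_letters _ None) => //; first by case=> [[]|].
  - by rewrite signs_two_letters twoE /unzip1 map_rcons -!/(unzip1 _) signs_two_letters.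
  - by have := orbit_reduced yP red; rewrite reduced_relabel.
have relabelE p y : relabel embed (rcons (two_letters p) (e, y)) =
    rcons (relabel embed (two_letters p)) (e, embed y) by rewrite /relabel map_rcons.
have [fxa|fxa] := eqVneq (f x) a.
  by exists None; rewrite relabelE /=; move: fP; rewrite fxa.
have [fxb|fxb] := eqVneq (f x) b.
  by exists (Some false); rewrite relabelE /=; move: fP; rewrite fxb.
exists (Some true); rewrite relabelE.
have := orbit_tperm (f x) c fP; rewrite /relabel map_rcons tpermL /=.
congr (orbit _ _ _ (rcons _ _)).
rewrite -map_comp; apply/eq_in_map => -[e' q] /mapP[e1 _ [_ ->]] /=.
by case: e1; rewrite /= tpermD // eq_sym.
Qed.

Lemma orbit_reduced_words u v :
  unzip1 u = unzip1 v -> reduced u -> reduced v -> orbit b c u v.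
Proof.
move=> uv /orbit_two_letters ru /orbit_two_letters/orbit_sym.
by rewrite -uv; apply: orbit_trans.
Qed.

End Transitivity.

(** On words of a fixed length [f] permutes a finite set, so its inverse is one of its iterates. *)
Lemma closed_under_inverse (T : finType) (f : seq T -> seq T) (P : seq T -> Prop) :
  injective f -> (forall w, size (f w) = size w) ->
  (forall w, P w -> P (f w)) -> forall w, P (f w) -> P w.
Proof.
move=> fI fS fP w Pfw.
pose F (t : (size w).-tuple T) := Tuple (introT eqP (etrans (fS t) (size_tuple t))).
have FI : injective F by move=> t t' /(congr1 val) /= /fI/val_inj.
have -> : w = finv F (F (in_tuple w)) by rewrite finv_f.
rewrite /finv; elim: _.-1 => [|k IH] //=; exact: fP.
Qed.

(** * The automaton states as a finite type *)

Section AleshinStates.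
Variable n : nat.

Definition aleshin_code (q : aleshin_state n) : option (option (option 'I_(2 * n - 2))) :=
  match q with
  | Aleshin_a => None
  | Aleshin_b => Some None
  | Aleshin_c => Some (Some None)
  | Aleshin_q j => Some (Some (Some j))
  end.

Definition aleshin_decode (x : option (option (option 'I_(2 * n - 2)))) : aleshin_state n :=
  match x with
  | None => Aleshin_a
  | Some None => Aleshin_b
  | Some (Some None) => Aleshin_c
  | Some (Some (Some j)) => Aleshin_q j
  end.

Lemma aleshin_codeK : cancel aleshin_code aleshin_decode.
Proof. by case. Qed.

Lemma aleshin_decodeK : cancel aleshin_decode aleshin_code.
Proof. by case=> [[[]|]|]. Qed.

HB.instance Definition _ := Finite.copy (aleshin_state n) (can_type aleshin_codeK).

Lemma card_aleshin_state : 1 <= n -> #|{: aleshin_state n}| = 2 * n + 1.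
Proof.
move=> hn; have codeB := Bijective aleshin_codeK aleshin_decodeK.
rewrite (bij_eq_card codeB) !card_option card_ord.
lia.
Qed.

End AleshinStates.

(** * Trivial words and the dual automaton *)

Section TrivialWords.
Variable n : nat.
Hypothesis hn : 1 <= n.

Local Notation Q := (aleshin_state n).
Local Notation a := (@Aleshin_a n).
Local Notation b := (@Aleshin_b n).
Local Notation c := (@Aleshin_c n).
Local Notation chain := (aleshin_chain n).
Implicit Types (q : Q) (w : seq (bool * Q)) (x e : bool) (s : seq bool).

(** For [e] true this is the inverse transformation: its transition reads the original input, which
    is [~~ x] at [a] and [b], while the other states ignore the letter. *)
Fixpoint letter_act e q s : seq bool :=
  if s is x :: s' then
    aleshin_output q x :: letter_act e (aleshin_transition q (x (+) e)) s'
  else [::].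

Lemma letter_actF q : letter_act false q =1 @transformation (aleshin n) q.
Proof. by move=> s; elim: s q => //= x s IH q; rewrite addbF IH. Qed.

Lemma aleshin_outputK q : involutive (aleshin_output q).
Proof. by case: q => [|||j] x //=; rewrite negbK. Qed.

Lemma letter_actTF q : cancel (letter_act false q) (letter_act true q).
Proof.
move=> s; elim: s q => //= x s IH q; rewrite aleshin_outputK addbF.
rewrite -{2}[s](IH (aleshin_transition q x)); congr (_ :: letter_act _ _ _).
by case: q => [|||j] //=; rewrite addbT negbK.
Qed.

Definition word_act w s := foldl (fun s l => letter_act l.1 l.2 s) s w.

(* The first letter of [w] acts first. *)
Definition trivial_word w := forall s, word_act w s = s.

Definition word_output w x := foldl (fun x l => aleshin_output l.2 x) x w.

(** The word that acts on the tail once [x] has been read; equivalently, the output of the dual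
    automaton started in [x]. *)
Fixpoint section x w : seq (bool * Q) :=
  if w is (e, q) :: w' then
    (e, aleshin_transition q (x (+) e)) :: section (aleshin_output q x) w'
  else [::].

Lemma word_act_cons w x s :
  word_act w (x :: s) = word_output w x :: word_act (section x w) s.
Proof. by elim: w x s => [|[e q] w IH] x s //=; rewrite -IH. Qed.

Lemma trivial_section x w : trivial_word w -> trivial_word (section x w).
Proof. by move=> wt s; have := wt (x :: s); rewrite word_act_cons => -[]. Qed.

Lemma trivial_output x w : trivial_word w -> word_output w x = x.
Proof. by move=> /(_ [:: x]); rewrite word_act_cons => -[]. Qed.

(** The cycle of length [2 * n] through [c], the chain and [a], with [b] fixed. *)
Let p q : Q := aleshin_transition q false.

Lemma chainS_neq i : (chain i.+1 != b) && (chain i.+1 != c).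
Proof. by rewrite /=; case: insubP. Qed.

(** Only at [a] and [b] does the transition depend on the letter, and there its two values are [b]
    and [c]. These are also the states that flip the letter, and [p] sends exactly them to [c] and
    [b], so [twist] tracks the running letter. *)
Lemma section_twist x w : section x w = twist b c x (relabel p w).
Proof.
elim: w x => [|[e q] w IH] x //=; rewrite {}IH; congr cons; last first.
  congr (twist _ _ _ _); have [/negbTE pb /negbTE pc] := andP (chainS_neq 0).
  by case: q => [|||j] /=; rewrite ?eqxx ?addbT ?pb ?pc ?addbF //;
    have [/negbTE -> /negbTE ->] := andP (chainS_neq j.+1); rewrite addbF.
congr pair; case: (x (+) e) => //; case: q => [|||j]; rewrite /p.
- by rewrite tpermR.
- by rewrite tpermL.
- by have [pb pc] := andP (chainS_neq 0); rewrite tpermD // eq_sym.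
- by have [pb pc] := andP (chainS_neq j.+1); rewrite tpermD // eq_sym.
Qed.

Lemma chain_last : chain (2 * n - 1) = a.
Proof.
have -> : 2 * n - 1 = (2 * n - 2).+1 by lia.
by rewrite /=; case: insubP => // j; rewrite ltnn.
Qed.

Lemma p_chain i : i < 2 * n - 1 -> p (chain i) = chain i.+1.
Proof.
case: i => [|i] // hi; rewrite /p [chain i.+1]/=.
have hi2 : i < 2 * n - 2 by lia.
by case: insubP => [j _ <-|]; rewrite ?hi2.
Qed.

Lemma state_chain q : q != b -> exists2 i, i < 2 * n & q = chain i.
Proof.
case: q => [||| j] // _; first by exists (2 * n - 1); rewrite ?chain_last //; lia.
  by exists 0 => //; lia.
exists j.+1; first by have := ltn_ord j; lia.
by rewrite /=; case: insubP => [k _ /val_inj -> //|]; rewrite ltn_ord.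
Qed.

Lemma p_inj : injective p.
Proof.
have pb : p b = b by [].
have pchain i : i < 2 * n -> p (chain i) = chain (if i == 2 * n - 1 then 0 else i.+1).
  by case: eqP => [->|ne hi]; rewrite ?chain_last // p_chain //; lia.
have chain_inj i j : i < 2 * n -> j < 2 * n -> chain i = chain j -> i = j.
  case: i j => [|i] [|j] //= hi hj; try by case: insubP.
  case: insubP => [k _ <-|hi']; case: insubP => [k' _ <-|hj'] //; first by case=> ->.
  by lia.
have chain_neqb i : chain i <> b by case: i => //= i; case: insubP.
have cyc i : i < 2 * n -> (if i == 2 * n - 1 then 0 else i.+1) < 2 * n.
  by case: eqP; lia.
move=> q q'; have [->|/state_chain[i hi ->]] := eqVneq q b;
  have [->|/state_chain[j hj ->]] := eqVneq q' b; rewrite ?pb ?pchain //.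
- by move=> /esym/chain_neqb.
- by move=> /chain_neqb.
- move=> /chain_inj ij; congr chain; have := ij (cyc _ hi) (cyc _ hj).
  by case: eqP; case: eqP; lia.
Qed.

(** A cycle of odd length [2 * n - 1] through the chain and [a], fixing [b] and [c]. *)
Let p' q : Q := p (tperm a c q).

Lemma p'_chain i : i <= 2 * n - 2 -> p' (chain i.+1) = chain ((i.+1 %% (2 * n - 1)).+1).
Proof.
move=> hi; have [->|ne] := eqVneq i (2 * n - 2).
  have -> : (2 * n - 2).+1 = 2 * n - 1 by lia.
  by rewrite modnn chain_last /p' tpermL.
have hi' : i.+1 < 2 * n - 1 by lia.
rewrite modn_small // /p' tpermD ?p_chain //; last first.
  by rewrite eq_sym; case/andP: (chainS_neq i).
by rewrite /=; case: insubP => //; lia.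
Qed.

Lemma iter_p' q : iter (2 * n - 1) p' q = q.
Proof.
have fixb : p' b = b by rewrite /p' tpermD.
have fixc : p' c = c by rewrite /p' tpermR.
have [->|/state_chain[[|i] hi ->]] := eqVneq q b; try by apply: iter_fix.
have gt0 : 0 < 2 * n - 1 by lia.
have iterE m : iter m p' (chain i.+1) = chain ((i + m) %% (2 * n - 1)).+1.
  elim: m => [|m IH]; first by rewrite addn0 modn_small //; lia.
  rewrite iterS IH p'_chain; last by have := ltn_pmod (i + m) gt0; lia.
  by rewrite -[((i + m) %% _).+1]addn1 modnDml addn1 addnS.
by rewrite iterE modnDr modn_small //; lia.
Qed.

Definition preserves_trivial f :=
  forall w, trivial_word w -> trivial_word (f w : seq (bool * Q)).

Lemma relabel_inj (f : Q -> Q) : injective f -> injective (relabel f).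
Proof. by move=> fI; apply: inj_map => -[e q] [e' q'] /= [-> /fI->]. Qed.

Lemma trivial_sectionV x w : trivial_word (section x w) -> trivial_word w.
Proof.
apply: closed_under_inverse w => [w w'|w|]; last exact: trivial_section.
  by rewrite !section_twist => /(inv_inj (@twistK _ _ _ _))/(relabel_inj p_inj).
by rewrite section_twist -(size_map fst) -/(unzip1 _) signs_twist signs_relabel size_map.
Qed.

(** Pulling [w] back along [section false] and pushing forward along [section true] swaps [b] and
    [c]. *)
Lemma trivial_tperm_bc : preserves_trivial (relabel (tperm b c)).
Proof.
move=> w wt; pose u := relabel (invF p_inj) (twist b c false w).
have uE x : section x u = twist b c x (twist b c false w).
  by rewrite section_twist /u /relabel -map_comp map_id_in // => -[e q] _ /=; rewrite f_invF.
have ut : trivial_word u by apply: (@trivial_sectionV false); rewrite uE twistK.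
by have := trivial_section true ut; rewrite uE -[true]/(~~ false) twist_negb twistK.
Qed.

(** Since [p] sends [a] to [c] and fixes [b], swapping [a] and [b] before [section false] yields
    [section true]. *)
Lemma trivial_tperm_ab : preserves_trivial (relabel (tperm a b)).
Proof.
move=> w wt; apply: (@trivial_sectionV false).
rewrite section_twist (relabel_tperm _ _ _ p_inj) -/(p a) [tperm _ _]tpermC.
by rewrite twist_tperm -section_twist; apply: trivial_section.
Qed.

Lemma trivial_tperm_ac : preserves_trivial (relabel (tperm a c)).
Proof.
move=> w wt; rewrite -[w](relabel_tpermK b c) -{1}(tpermL b c).
have -> : a = tperm b c a by rewrite tpermD.
rewrite tpermL -{2}(tpermL b c) -relabel_tperm; last exact: perm_inj.
exact/trivial_tperm_bc/trivial_tperm_ab/trivial_tperm_bc.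
Qed.

(* [p'] fixes [b] and [c], so relabelling by [p'] commutes with [twist]; its order divides
   the odd number [2 * n - 1] while [twist] is an involution. *)
Lemma trivial_twist x : preserves_trivial (twist b c x).
Proof.
have p'_inj : injective p' by move=> q q' /p_inj/perm_inj.
have fixb : p' b = b by rewrite /p' tpermD.
have fixc : p' c = c by rewrite /p' tpermR.
pose g w := section false (relabel (tperm a c) w).
have gE w : g w = twist b c false (relabel p' w).
  by rewrite /g section_twist; congr twist; rewrite /relabel -map_comp.
have iter_g k w : iter k g w =
    iter k (twist b c false) (relabel (iter k p') w).
  elim: k w => [|k IH] w; first by rewrite relabel_id_in.
  rewrite iterS IH gE {IH gE}; congr (twist _ _ _ _).
  have -> : relabel (iter k.+1 p') w = relabel p' (relabel (iter k p') w).
    by rewrite /relabel -map_comp.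
  elim: k (relabel _ w) => //= k IH v.
  by rewrite relabel_twist // fixb fixc IH.
(* After [2 * n - 1] rounds the relabelling is the identity, and an odd number of twists leaves
   one. *)
have twist0 w : twist b c false w = iter (2 * n - 1) g w.
  rewrite iter_g (@relabel_id_in _ _ w) => [|q _]; last exact: iter_p'.
  have -> : 2 * n - 1 = (2 * (n - 1)).+1 by lia.
  rewrite iterS; congr twist; elim: (n - 1) => // k IH.
  by rewrite mulnS iterD -IH /= twistK.
have pres0 : preserves_trivial (twist b c false).
  move=> w wt; rewrite twist0; elim: (2 * n - 1) => //= k IH.
  exact/trivial_section/trivial_tperm_ac.
case: x => // w wt; rewrite -[true]/(~~ false) twist_negb.
exact/trivial_tperm_bc/pres0.
Qed.

Lemma trivial_p : preserves_trivial (relabel p).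
Proof.
move=> w wt; rewrite -[relabel p w](twistK b c false) -section_twist.
exact/trivial_twist/trivial_section.
Qed.

Lemma trivial_pV w : trivial_word (relabel p w) -> trivial_word w.
Proof.
apply: closed_under_inverse w => [|w|]; [exact: relabel_inj p_inj | by rewrite size_map|].
exact: trivial_p.
Qed.

(** Conjugating the swap of [b] and [c] by powers of [p], which fixes [b], moves [c] along the whole
    chain. *)
Lemma trivial_tperm_b q : preserves_trivial (relabel (tperm b q)).
Proof.
have [->|/state_chain[i hi ->]] := eqVneq q b.
  by move=> w wt; rewrite relabel_id_in // => q' _; rewrite tperm1 perm1.
elim: i hi => [_|i IH hi]; first exact: trivial_tperm_bc.
rewrite -p_chain; last by lia.
move=> w wt; pose u := relabel (invF p_inj) w.
have uE : w = relabel p u.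
  by rewrite /u /relabel -map_comp map_id_in // => -[e q'] _ /=; rewrite f_invF.
rewrite uE -[b]/(p b) -relabel_tperm; last exact: p_inj.
by apply/trivial_p/IH; [lia|apply: trivial_pV; rewrite -uE].
Qed.

Lemma trivial_tperm (q q' : Q) : preserves_trivial (relabel (tperm q q')).
Proof.
have [->|qb] := eqVneq q b; first exact: trivial_tperm_b.
have [->|q'b] := eqVneq q' b; first by rewrite tpermC; apply: trivial_tperm_b.
have [->|qq'] := eqVneq q q'.
  by move=> w wt; rewrite relabel_id_in // => t _; rewrite tperm1 perm1.
have -> : tperm q q' = tperm (tperm b q b) (tperm b q q').
  by rewrite tpermL [tperm b q q']tpermD // eq_sym.
move=> w wt; rewrite -[w](relabel_tpermK b q) -relabel_tperm; last exact: perm_inj.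
exact/trivial_tperm_b/trivial_tperm_b/trivial_tperm_b.
Qed.

Lemma trivial_orbit u v : orbit b c u v -> trivial_word u -> trivial_word v.
Proof.
move=> uv ut; elim: uv => // [q q'|s] {}v _ vt; first exact: trivial_tperm.
exact: trivial_twist.
Qed.

Lemma trivial_reduced w : trivial_word w -> reduced w -> w = [::].
Proof.
case: w => // -[e q] w wt red.
pose two r : seq (bool * Q) := [seq (e, if e then a else b) | e <- r].
have signs_two r : unzip1 (two r) = r by rewrite /unzip1 -map_comp map_id.
have red_two r : reduced (two r).
  rewrite /reduced sorted_map; case: r => //= e1 r; elim: r e1 => //= e2 r IH e1.
  by rewrite IH andbT; case: e1 e2 => [] [].
have out_two r x : word_output (two r) x = x (+) odd (size r).
  elim: r x => [|e1 r IH] x; first by rewrite addbF.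
  rewrite /word_output /= -/(word_output _ _) IH.
  by case: (e1); rewrite /= addNb addbN.
have no_two v : unzip1 v = e :: unzip1 w -> reduced v -> ~ word_output v true = false.
  move=> vw rv; rewrite trivial_output //; apply: trivial_orbit wt.
  by apply: (@orbit_reduced_words _ a).
have [odd_w|even_w] := boolP (odd (size w)).
  (* The total length is even here; a leading [c] flips nothing and cancels with neither [a] nor
     [b], so an odd number of flips remains. *)
  case: (no_two ((e, c) :: two (unzip1 w))); first by rewrite /= signs_two.
    rewrite /reduced /=; have := red_two (unzip1 w).
    rewrite /reduced; case: (unzip1 w) => //= e1 r ->; rewrite andbT.
    by apply/orP; right; case: (e1).
  by rewrite -[LHS]/(word_output (two (unzip1 w)) true) out_two size_map odd_w.
case: (no_two (two (e :: unzip1 w))); [exact: signs_two|exact: red_two|].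
by rewrite out_two /= size_map even_w.
Qed.

End TrivialWords.

(** * Evaluation of words in groups and the universal property *)

Section WordEvaluation.
Variable Q : eqType.
Implicit Types (w : seq (bool * Q)).

Definition word_eval (G : groupType) (f : Q -> G) w : G :=
  foldr (fun l g => (if l.1 then (f l.2)^-1 else f l.2) * g) 1 w.

Lemma word_eval_cat (G : groupType) (f : Q -> G) w w' :
  word_eval f (w ++ w') = word_eval f w * word_eval f w'.
Proof. by elim: w => [|l w IH] /=; rewrite ?mul1g // IH mulgA. Qed.

Lemma word_eval_inv (G : groupType) (f : Q -> G) w :
  word_eval f (inv_word w) = (word_eval f w)^-1.
Proof.
elim: w => [|[e q] w IH]; first by rewrite invg1.
rewrite inv_word_cons -cats1 word_eval_cat IH /= invgM mulg1.
by case: e; rewrite /= ?invgK.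
Qed.

Lemma word_eval_morph (G H : groupType) (phi : {multiplicative G -> H}) (f : Q -> G) w :
  phi (word_eval f w) = word_eval (phi \o f) w.
Proof.
have phi1 : phi 1 = 1 by apply: (mulgI (phi 1)); rewrite -gmulfM !mulg1.
have phiV x : phi x^-1 = (phi x)^-1 by apply: (mulgI (phi x)); rewrite -gmulfM !mulgV.
by elim: w => [|[e q] w IH] //=; rewrite gmulfM IH; case: e; rewrite /= ?phiV.
Qed.

(** The shorter word is chosen before the group, so one cancellation serves the source and the
    target of a homomorphism alike. *)
Lemma word_eval_cancel w : ~~ reduced w -> exists2 w', size w' < size w &
  forall (G : groupType) (f : Q -> G), word_eval f w' = word_eval f w.
Proof.
rewrite /reduced; case: w => //= l w; elim: w l => //= l' w IH l.
rewrite negb_and => /orP[|/IH[w' sw' w'E]]; last first.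
  by exists (l :: w') => // G f; rewrite /= w'E.
rewrite /nocancel negb_or negbK => /andP[ne /eqP eq2].
exists w => [|G f]; first exact: ltnW.
case: l l' ne eq2 => [e q] [e' q'] /= ne ->.
by rewrite mulgA; case: e e' ne => [] [] //= _; rewrite ?mulVg ?mulgV mul1g.
Qed.

(** A word trivial in [G] cancels down to the empty word, hence is trivial in every [H]; evaluation
    in [H] therefore factors through [G]. *)
Lemma free_basis_no_relation (G : groupType) k (h : 'I_k -> Q) (f : Q -> G) : bijective h ->
  (forall g, exists w, g = word_eval f w) ->
  (forall w, word_eval f w = 1 -> reduced w -> w = [::]) ->
  is_free_basis (f \o h).
Proof.
move=> [h' hK h'K] fgen ffree H e0; pose e := e0 \o h'.
have eval1 w : word_eval f w = 1 -> word_eval e w = 1.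
  elim: {w}_.+1 {-2}w (ltnSn (size w)) => // m IH w sw w1.
  have [/(ffree w w1) -> //|/word_eval_cancel[w' sw' w'E]] := boolP (reduced w).
  by rewrite -w'E IH ?w'E //; apply: leq_trans sw' _.
have eval_eq w w' : word_eval f w = word_eval f w' -> word_eval e w = word_eval e w'.
  move=> ww'; apply/eqP; rewrite -divg_eq1 -word_eval_inv -word_eval_cat; apply/eqP/eval1.
  by rewrite word_eval_cat word_eval_inv ww' mulgV.
(* An arbitrary word representing [g] is chosen; [eval_eq] makes the value independent of it. *)
pose phi g := word_eval e (sval (cid (fgen g))).
have phiE w : phi (word_eval f w) = word_eval e w.
  by apply: eval_eq; rewrite -(svalP (cid (fgen _))).
have phiM : {morph phi : x y / x * y}.
  move=> x y; have [w ->] := fgen x; have [w' ->] := fgen y.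
  by rewrite -word_eval_cat !phiE word_eval_cat.
pose phim : {multiplicative G -> H} := HB.pack phi (isMultiplicative.Build G H phi phiM).
exists phim; split=> [i|psi psiE g].
  have -> : (f \o h) i = word_eval f [:: (false, h i)] by rewrite /= mulg1.
  by rewrite [LHS]phiE /= mulg1 /e /= hK.
have [w ->] := fgen g; rewrite [RHS]phiE word_eval_morph.
elim: w => //= -[b q] w ->; congr (_ * _).
by have := psiE (h' q); rewrite /= /e /= h'K => ->.
Qed.

End WordEvaluation.

(** * Words evaluated in the automaton group *)

Section AleshinGroup.
Variable n : nat.
Local Notation Q := (aleshin_state n).
Local Notation G := (automaton_group (aleshin_invertible n)).

Let perm_of (q : Q) : bijection (seq bool) := Bijection (aleshin_invertible n q).

Lemma generated_perm_of q :
  perm_of q \in Defs.generated [set Bijection (aleshin_invertible n q) | q in [set: Q]]%classic.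
Proof. by rewrite unfold_in; apply/asboolP => A _; apply; exists q. Qed.

Definition aleshin_generator (q : Q) : G := Sub (perm_of q) (generated_perm_of q).

(** In a product the right factor acts first, whereas [word_act] applies the first letter first;
    hence the reversal. *)
Lemma word_eval_act w s :
  val (word_eval aleshin_generator w) s = word_act (rev w) s.
Proof.
rewrite /word_act foldl_rev; elim: w => //= -[e q] w IH.
rewrite -IH; case: e => /=; last by rewrite letter_actF.
set s' := (X in letter_act _ _ X).
by rewrite -[s' in RHS](bij_invK (perm_of q)) /= -letter_actF letter_actTF.
Qed.

Lemma aleshin_generated (g : G) : exists w, g = word_eval aleshin_generator w.
Proof.
case: g => g gS; suff [w gw] : exists w, g = val (word_eval aleshin_generator w).
  by exists w; apply: val_inj.
pose A g := exists w, g = val (word_eval aleshin_generator w).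
move: (gS) => /asboolP/(_ A).
apply; first split.
- by exists [::].
- by move=> _ _ [w ->] [w' ->]; exists (w ++ w'); rewrite word_eval_cat.
- by move=> _ [w ->]; exists (inv_word w); rewrite word_eval_inv.
by move=> _ [q _ <-]; exists [:: (false, q)]; rewrite /= mulg1.
Qed.

End AleshinGroup.

Theorem theorem1p2 (n : nat) (hn : 1 <= n) :
  is_free_group (automaton_group (aleshin_invertible n)) (2 * n + 1).
Proof.
pose h (i : 'I_(2 * n + 1)) : aleshin_state n :=
  enum_val (cast_ord (esym (card_aleshin_state hn)) i).
exists (@aleshin_generator n \o h); apply: free_basis_no_relation.
- exists (cast_ord (card_aleshin_state hn) \o enum_rank) => [i|q].
    by rewrite /h /= enum_valK cast_ordKV.
  by rewrite /h /= cast_ordK enum_rankK.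
- exact: aleshin_generated.
(* The word that acts is the reversed one; it is still reduced because [nocancel] is symmetric. *)
- move=> w w1 red; apply: (can_inj (@revK _)); apply: (trivial_reduced hn).
    by move=> s; rewrite -word_eval_act w1.
  rewrite /reduced rev_sorted; move: red; apply: sub_sorted => l l'.
  by rewrite nocancel_sym.
Qed.
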